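(* Let $L\ge 1$, and let $(X_j,x_j)$ and $(Y_j,y_j)$, $j\in\mathbb{N}$, be two pointed sequences of locally compact and complete path-metric spaces. Suppose that the sequence of pointed mapping packages $((X_j,x_j),(Y_j,y_j),f_j)$, where each $f_j\colon (X_j,x_j)\to(Y_j,y_j)$ is $L$-BLD, converges to a pointed mapping package $((X,x_0),(Y,y_0),f)$ where $f$ is discrete. Then $f$ is $L$-BLD.
   Context: A path is a continuous map on $[0,1]$; $\ell(\gamma)\in[0,\infty]$ is its length. A metric space $(X,d)$ is a path-metric space if $d(x,y)$ is the infimum of lengths of paths from $x$ to $y$, for all $x,y$. A mapping is discrete if all point inverses are discrete sets; a branched cover is a continuous, discrete and open mapping. $f\colon X\to Y$ is $L$-BLD if it is a branched cover and $L^{-1}\ell(\gamma)\le\ell(f\circ\gamma)\le L\,\ell(\gamma)$ for all paths $\gamma\colon[0,1]\to X$. A pointed mapping package is a triple $((X,x_0),(Y,y_0),f)$ where $X,Y$ are locally compact and complete path-metric spaces with base points $x_0\in X$, $y_0\in Y$, and $f\colon X\to Y$ is a continuous mapping with $f(x_0)=y_0$. Balls $B(\cdot,\cdot)$ are open, and $N_\varepsilon(A)=\{x : d(x,A)<\varepsilon\}$. A (not necessarily continuous) map $\phi\colon(X,x_0)\to(Y,y_0)$ between pointed metric spaces is an $\varepsilon$-quasi-isometry if (1) $|d(\phi(a),\phi(b))-d(a,b)|<\varepsilon$ for all $a,b\in B_X(x_0,\varepsilon^{-1})$, and (2) $N_\varepsilon(\phi(B_X(x_0,r)))\supset B_Y(y_0,r-\varepsilon)$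 for all $\varepsilon\le r\le\varepsilon^{-1}$. Pointed mapping packages $((X_j,x_j),(Y_j,y_j),f_j)$, $j\in\mathbb{N}$, converge to $((X,x_0),(Y,y_0),f)$ if: (GH-i) For every $r>0$ and $i\in\mathbb{N}$ there exist $\varepsilon_i^{(r)}>0$ and $\varepsilon_i^{(r)}$-quasi-isometries $g_i^{(r)}\colon B_{X_i}(x_i,r)\to N_{\varepsilon_i^{(r)}}(g_i^{(r)}(B_{X_i}(x_i,r)))\subset X$ and $h_i^{(r)}\colon B_{Y_i}(y_i,r)\to N_{\varepsilon_i^{(r)}}(h_i^{(r)}(B_{Y_i}(y_i,r)))\subset Y$ such that $\varepsilon_i^{(r)}\to0$ as $i\to\infty$, and for all $i$: $g_i^{(r)}(x_i)=x_0$, $h_i^{(r)}(y_i)=y_0$, $B(x_0,r-\varepsilon_i^{(r)})\subset N_{\varepsilon_i^{(r)}}(g_i^{(r)}(B_{X_i}(x_i,r)))$ and $B(y_0,r-\varepsilon_i^{(r)})\subset N_{\varepsilon_i^{(r)}}(h_i^{(r)}(B_{Y_i}(y_i,r)))$. (GH-ii) For these maps, for every $a\in X$ and all $r>d(a,x_0)$, $h_i^{(r)}(f_i(a_i))\to f(a)$ as $i\to\infty$ whenever $a_i\in B_{X_i}(x_i,r)$ is a sequence with $g_i^{(r)}(a_i)\to a$ and $f_i(a_i)\in B_{Y_i}(y_i,r)$ for all sufficiently large $i$ (so that the expression is defined). *)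

(* Defs.v *)
From HB Require Import structures.
From mathcomp Require Import all_boot all_order all_algebra.
From mathcomp Require Import all_classical all_reals all_analysis.

Set Implicit Arguments.
Unset Strict Implicit.
Unset Printing Implicit Defensive.

Import Order.TTheory GRing.Theory Num.Theory.
Import numFieldNormedType.Exports.

Local Open Scope classical_set_scope.
Local Open Scope ring_scope.

Section Metric.
Context {R : realType}.
Implicit Types X Y : metricType R.

(* A path is a total function on R of which only the values on `[0, 1] matter. *)
Definition is_path X (gamma : R -> X) := {within `[0, 1], continuous gamma}.

(* As in [variation] and [itv_partition], the partition
   0 = t_0 < t_1 < ... < t_n = 1 is given by s = [:: t_1; ...; t_n]. *)
Definition polygonal_length X (gamma : R -> X) (s : seq R) : R :=
  let p := gamma \o nth 1 (0 :: s) in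
  \sum_(0 <= n < size s) mdist (p n) (p n.+1).

Definition path_length X (gamma : R -> X) : \bar R :=
  ereal_sup [set (polygonal_length gamma s)%:E | s in itv_partition 0 1].

(* The infimum of the empty set is +oo, so any two points of a path-metric
   space are joined by a path. *)
Definition path_metric_space X := forall x y : X,
  (mdist x y)%:E = ereal_inf [set path_length gamma | gamma in
    [set gamma : R -> X | [/\ is_path gamma, gamma 0 = x & gamma 1 = y]]].

(* The library's complete structures are pointed; metricType is not. *)
Definition complete_space X := forall u : nat -> X,
  cauchy (u @ \oo) -> exists l : X, u @ \oo --> l.

Definition discrete_set X (A : set X) := A `<=` isolated A.

Definition discrete_map X Y (f : X -> Y) :=
  forall y, discrete_set (f @^-1` [set y]).

Definition open_map X Y (f : X -> Y) := forall U, open U -> open (f @` U).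

Definition branched_cover X Y (f : X -> Y) :=
  [/\ continuous f, discrete_map f & open_map f].

Definition BLD (L : R) X Y (f : X -> Y) :=
  branched_cover f /\
  forall gamma : R -> X, is_path gamma ->
    (L^-1%:E * path_length gamma <= path_length (f \o gamma))%E /\
    (path_length (f \o gamma) <= L%:E * path_length gamma)%E.

Definition set_dist X (x : X) (A : set X) : \bar R :=
  ereal_inf [set (mdist x a)%:E | a in A].

Definition set_nbhd X (e : R) (A : set X) : set X :=
  [set x | (set_dist x A < e%:E)%E].

(* phi is a map from the metric subspace A (based at x0) to the metric subspace
   B (based at y0), encoded by a total function whose values outside A are
   irrelevant; balls and neighbourhoods are those of the subspaces. *)
Definition quasi_isometry X Y (A : set X) (x0 : X) (B : set Y) (y0 : Y)
    (e : R) (phi : X -> Y) :=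
  [/\ phi @` A `<=` B,
      forall a b, (A `&` ball x0 e^-1) a -> (A `&` ball x0 e^-1) b ->
        `|mdist (phi a) (phi b) - mdist a b| < e &
      forall r, e <= r <= e^-1 ->
        B `&` ball y0 (r - e) `<=`
        B `&` set_nbhd e (phi @` (A `&` ball x0 r))].

End Metric.

Record mapping_package (R : realType) := MappingPackage {
  pkg_dom : metricType R;
  pkg_cod : metricType R;
  pkg_dom_base : pkg_dom;
  pkg_cod_base : pkg_cod;
  pkg_map : pkg_dom -> pkg_cod;
  pkg_dom_locally_compact : locally_compact [set: pkg_dom];
  pkg_dom_complete : complete_space pkg_dom;
  pkg_dom_path_metric : path_metric_space pkg_dom;
  pkg_cod_locally_compact : locally_compact [set: pkg_cod];
  pkg_cod_complete : complete_space pkg_cod;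
  pkg_cod_path_metric : path_metric_space pkg_cod;
  pkg_map_continuous : continuous pkg_map;
  pkg_map_base : pkg_map pkg_dom_base = pkg_cod_base
}.

Section Convergence.
Context {R : realType}.

(* g is only used on B(x, r); its codomain is the metric subspace
   N_e(g(B(x, r))) of X0. *)
Definition gh_approximation (X X0 : metricType R) (x : X) (x0 : X0)
    (r e : R) (g : X -> X0) :=
  let image_nbhd := set_nbhd e (g @` ball x r) in
  [/\ quasi_isometry (ball x r) x image_nbhd x0 e g,
      g x = x0 &
      ball x0 (r - e) `<=` image_nbhd].

Definition package_cvg (P : nat -> mapping_package R) (Q : mapping_package R) :=
  exists (eps : R -> nat -> R)
         (g : R -> forall i, pkg_dom (P i) -> pkg_dom Q)
         (h : R -> forall i, pkg_cod (P i) -> pkg_cod Q),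
    (forall r, 0 < r ->
      [/\ forall i, 0 < eps r i,
          eps r i @[i --> \oo] --> (0 : R),
          forall i, gh_approximation (pkg_dom_base (P i)) (pkg_dom_base Q)
                      r (eps r i) (g r i) &
          forall i, gh_approximation (pkg_cod_base (P i)) (pkg_cod_base Q)
                      r (eps r i) (h r i)]) /\
    (forall (a : pkg_dom Q) (r : R), mdist a (pkg_dom_base Q) < r ->
      forall a_ : forall i, pkg_dom (P i),
        (forall i, ball (pkg_dom_base (P i)) r (a_ i)) ->
        g r i (a_ i) @[i --> \oo] --> a ->
        (\forall i \near \oo,
           ball (pkg_cod_base (P i)) r (pkg_map (a_ i))) ->
        h r i (pkg_map (a_ i)) @[i --> \oo] --> pkg_map a).

End Convergence.

(* Main.v *)
(* BLD maps are Lipschitz, and co-Lipschitz in the sense that every [y] with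
   [L d(f x, y) < c] has a preimage at distance less than [c] from [x]: near [x]
   one lifts an almost shortest path from [f x] to [y], whose lift is at most
   [L] times longer, and completeness of the domain makes the local statement
   global. Both bounds pass to the limit, the second one locally.
   Conversely, let [f] be discrete with these two bounds. It is open, and near
   [x] the only preimage of [f x] is [x], so the co-Lipschitz bound at a nearby
   [a] gives [d(x, a) <= L d(f x, f a)]. Although this estimate holds only with
   one end point fixed, partitions refined to pass through enough such points
   give [l(gamma) <= L l(f o gamma)]. *)
Require Import Defs.
From mathcomp Require Import all_boot all_order all_algebra.
From mathcomp Require Import all_classical all_reals all_analysis.
From mathcomp Require Import ring lra.

Set Implicit Arguments.
Unset Strict Implicit.
Unset Printing Implicit Defensive.

Import Order.TTheory GRing.Theory Num.Theory.
Import numFieldNormedType.Exports.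

Local Open Scope classical_set_scope.
Local Open Scope ring_scope.

(** * Metric and compactness facts *)

Section MetricFacts.
Context {R : realType}.
Implicit Types X Y : metricType R.

Lemma mdistC X (x y : X) : mdist x y = mdist y x.
Proof. exact: metric_sym. Qed.

Lemma mdistD X (x y z : X) : mdist x z <= mdist x y + mdist y z.
Proof. exact: metric_triangle. Qed.

Lemma ler_addMeps (x y C : R) : 0 < C ->
  (forall e, 0 < e -> x <= y + C * e) -> x <= y.
Proof.
move=> C0 H; apply/ler_addgt0Pr => e e0.
by have := H (e / C) (divr_gt0 e0 C0); rewrite mulrCA divff ?gt_eqF// mulr1.
Qed.

Lemma invS_lt_near (e : R) : 0 < e -> \forall n \near \oo, n.+1%:R^-1 < e.
Proof. by move=> e0; exact: near_infty_natSinv_lt (PosNum e0). Qed.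

Lemma ball_mdistE X (x y : X) (e : R) : ball x e y = (mdist x y < e).
Proof. by rewrite ballEmdist. Qed.

Lemma cvg_mdistP X (T : Type) (F : set_system T) (FF : Filter F) (u : T -> X) l :
  (u x @[x --> F] --> l) <->
  forall e : R, 0 < e -> \forall x \near F, mdist l (u x) < e.
Proof.
split=> [/cvg_ballP H e e0|H].
  by apply: filterS (H e e0) => x /=; rewrite ball_mdistE.
by apply/cvg_ballP => e e0; apply: filterS (H e e0) => x; rewrite ball_mdistE.
Qed.

Lemma nbhs_mdistP X (x : X) (A : set X) :
  nbhs x A <-> exists2 e : R, 0 < e & forall y, mdist x y < e -> A y.
Proof.
split=> [/nbhs_ballP[e /= e0 eA]|[e e0 eA]].
  by exists e => // y xy; apply: eA; rewrite ball_mdistE.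
by apply/nbhs_ballP; exists e => //= y; rewrite ball_mdistE; exact: eA.
Qed.

Lemma continuous_mdistP X Y (f : X -> Y) (x : X) :
  {for x, continuous f} <-> forall e : R, 0 < e ->
  exists2 d : R, 0 < d & forall y, mdist x y < d -> mdist (f x) (f y) < e.
Proof.
split=> [/cvg_mdistP H e /H /nbhs_mdistP//|H].
by apply/cvg_mdistP => e e0; apply/nbhs_mdistP; exact: H.
Qed.

Lemma is_pathP X (gamma : R -> X) : is_path gamma <->
  forall t, 0 <= t <= 1 -> forall e : R, 0 < e -> exists2 d : R, 0 < d &
    forall s, 0 <= s <= 1 -> `|t - s| < d -> mdist (gamma t) (gamma s) < e.
Proof.
rewrite /is_path subspace_continuousP; split => H t t01.
  move=> e e0; have /H/cvg_mdistP/(_ _ e0) : [set` `[0 : R, 1]] t by rewrite /= in_itv.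
  rewrite /within/= => /nbhs_ballP[d /= d0 dH].
  by exists d => // s s01 ts; apply: dH => //=; rewrite in_itv.
move: t01; rewrite /= in_itv/= => t01.
apply/cvg_mdistP => e e0; rewrite /within/=; apply/nbhs_ballP.
have [d d0 dH] := H t t01 e e0; exists d => //= s ts.
by rewrite in_itv/=; move/dH; exact.
Qed.

Lemma locally_compact_mdist X : locally_compact [set: X] -> forall x : X,
  exists K (e : R), [/\ compact K, 0 < e & forall y, mdist x y < e -> K y].
Proof.
move=> lc x; have [K] := lc x I; rewrite withinET => /nbhs_mdistP[e e0 eK] [cK _].
by exists K, e.
Qed.

(** An ultrafilter contains each set or its complement, so a cluster point of [u] along [U] is
    already a limit. *)
Lemma compact_ultralimit X (K : set X) (U : set_system nat) (u : nat -> X) :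
  compact K -> UltraFilter U -> (\forall n \near U, K (u n)) ->
  exists2 z, K z & forall e : R, 0 < e -> \forall n \near U, mdist z (u n) < e.
Proof.
move=> cK UU uK; have [z [Kz zu]] := cK (u @ U) _ uK.
exists z => // e e0.
have [//|nUe] := in_ultra_setVsetC [set n | mdist z (u n) < e] UU.
have [] := zu (~` [set y | mdist z y < e]) [set y | mdist z y < e].
- by [].
- by apply/nbhs_mdistP; exists e.
- by move=> y [].
Qed.

(** Stands in for a convergent subsequence: the free [P] lets an index with [u n] near [z] also
    satisfy whatever holds eventually. *)
Lemma compact_cluster_seq X (K : set X) (u : nat -> X) :
  compact K -> (\forall n \near \oo, K (u n)) ->
  exists2 z, K z & forall (e : R) (P : set nat), 0 < e ->
    (\forall n \near \oo, P n) -> exists2 n, P n & mdist z (u n) < e.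
Proof.
move=> cK uK; have [U [UU oU]] := ultraFilterLemma (eventually_filter).
have [z Kz zu] := compact_ultralimit cK UU (oU _ uK).
exists z => // e P e0 /oU UP.
by have [n [Pn zn]] := filter_ex (filterI UP (zu e e0)); exists n.
Qed.

Lemma discrete_mdist X (A : set X) (x : X) : discrete_set A -> A x ->
  exists2 e : R, 0 < e & forall y, A y -> mdist x y < e -> y = x.
Proof.
move=> dA Ax; have [_ [V /nbhs_mdistP[e e0 eV] VA]] := dA x Ax.
exists e => // y Ay /eV Vy.
by have : [set x] y by rewrite -VA.
Qed.

Lemma open_map_mdist X Y (f : X -> Y) (x : X) (e : R) : open_map f -> 0 < e ->
  exists2 d : R, 0 < d &
    forall y, mdist (f x) y < d -> exists2 z, mdist x z < e & f z = y.
Proof.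
move=> fo e0; pose U := (ball x e)°.
have Ux : U x by apply: nbhsx_ballx.
have : nbhs (f x) (f @` U).
  by apply: open_nbhs_nbhs; split; [exact/fo/open_interior|exists x].
move=> /nbhs_mdistP[d d0 dU]; exists d => // y /dU[z Uz <-]; exists z => //.
by rewrite -ball_mdistE; exact: interior_subset.
Qed.

(** If the radius shrank along [x_n], openness at a cluster point [z] of the [x_n], applied with
    [e / 2], would produce the missing preimages. *)
Lemma uniformly_open_compact X Y (f : X -> Y) (K : set X) (e : R) :
  continuous f -> open_map f -> compact K -> 0 < e ->
  exists2 d : R, 0 < d & forall x y, K x -> mdist (f x) y < d ->
    exists2 z, mdist x z < e & f z = y.
Proof.
move=> fc fo cK e0; apply: contrapT => nd.
have bad n : exists xy : X * Y, [/\ K xy.1, mdist (f xy.1) xy.2 < n.+1%:R^-1 &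
    forall z, mdist xy.1 z < e -> f z <> xy.2].
  apply: contrapT => H; apply: nd; exists n.+1%:R^-1 => // x y Kx xy.
  apply: contrapT => nz; apply: H; exists (x, y); split => //= z xz fz.
  by apply: nz; exists z.
have {bad} [xy bad] := choice bad.
have [|z Kz zx] := compact_cluster_seq (u := fun n => (xy n).1) cK.
  by near=> n; have [] := bad n.
have [d d0 dH] := open_map_mdist z fo (divr_gt0 e0 (ltr0n _ 2)).
have [a a0 aH] := (continuous_mdistP f z).1 (fc z) _ (divr_gt0 d0 (ltr0n _ 2)).
have ma0 : 0 < Num.min a (e / 2) by rewrite lt_min a0 divr_gt0.
have [n /= nd2] := zx _ _ ma0 (invS_lt_near (divr_gt0 d0 (ltr0n _ 2))).
rewrite lt_min /= => /andP[/aH zxa zxe].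
have [_ /lt_trans/(_ nd2) xyn nH] := bad n.
have [|w zw fw] := dH (xy n).2.
  by have := mdistD (f z) (f (xy n).1) (xy n).2; lra.
apply: (nH w) => //.
by have := mdistD (xy n).1 z w; rewrite (mdistC _ z); lra.
Unshelve. all: by end_near. Qed.

(** Points of the annulus whose images tend to [f p] would cluster at a point of the fibre of [f p].
    Near [p] this fibre is [{p}], and [p] is not in the annulus. *)
Lemma annulus_gap X Y (f : X -> Y) (p : X) (r0 : R) :
  locally_compact [set: X] -> continuous f -> discrete_map f -> 0 < r0 ->
  exists r d : R, [/\ 0 < r <= r0, 0 < d &
    forall u, r / 2 <= mdist p u <= r -> d <= mdist (f p) (f u)].
Proof.
move=> lc fc fd r00.
have [K [e [cK e0 eK]]] := locally_compact_mdist lc p.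
have [i i0 iH] := @discrete_mdist X _ p (fd (f p)) erefl.
(* [r < e] keeps the annulus inside the compact set [K]; [r < i] leaves no fibre point other than
   [p] within reach. *)
pose r := Num.min r0 (Num.min (e / 2) (i / 2)).
have r_gt0 : 0 < r by rewrite !lt_min r00 !divr_gt0.
have [rr0 re ri] : [/\ r <= r0, r < e & r < i].
  rewrite /r !ge_min lexx; split => //.
    by rewrite !gt_min; apply/orP; right; apply/orP; left; lra.
  by rewrite !gt_min; apply/orP; right; apply/orP; right; lra.
exists r; apply: contrapT => nd.
have bad n : exists u, r / 2 <= mdist p u <= r /\
    mdist (f p) (f u) < n.+1%:R^-1.
  apply: contrapT => H; apply: nd; exists n.+1%:R^-1; split => //.
    by rewrite r_gt0.
  by move=> u ur; rewrite leNgt; apply/negP => fu; apply: H; exists u.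
have {bad} [u bad] := choice bad.
have [|z Kz zu] := compact_cluster_seq (u := u) cK.
  by near=> n; have [/andP[_ ur] _] := bad n; apply: eK; lra.
have fz : f z = f p.
  apply/esym/mdist_positivity/eqP; rewrite eq_le mdist_ge0 andbT.
  apply: (@ler_addMeps _ _ 2) => // a a0; rewrite add0r.
  have [b b0 bH] := (continuous_mdistP f z).1 (fc z) _ a0.
  have [n /= na /bH zn] := zu _ _ b0 (invS_lt_near a0).
  have [_ /lt_trans/(_ na) fu] := bad n.
  by have := mdistD (f p) (f (u n)) (f z); rewrite (mdistC (f (u n))); lra.
have close a : 0 < a -> exists2 n, True & mdist z (u n) < a.
  by move=> a0; apply: zu => //; exact: filterT.
have [n _ zn] := close _ (divr_gt0 r_gt0 (ltr0n _ 2)).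
have zp : z = p.
  apply: iH; first by rewrite /= fz.
  have [m _ zm] : exists2 m, True & mdist z (u m) < i - r by apply: close; lra.
  have [/andP[_ um] _] := bad m.
  by have := mdistD p (u m) z; rewrite (mdistC (u m)); lra.
by have [/andP[um _] _] := bad n; move: zn; rewrite zp; lra.
Unshelve. all: by end_near. Qed.

Lemma is_path_unif X (beta : R -> X) (e : R) : is_path beta -> 0 < e ->
  exists2 d : R, 0 < d & forall s t, 0 <= s <= 1 -> 0 <= t <= 1 ->
    `|s - t| < d -> mdist (beta s) (beta t) < e.
Proof.
move=> /is_pathP bp e0; apply: contrapT => nd.
have bad n : exists st : R * R, [/\ 0 <= st.1 <= 1, 0 <= st.2 <= 1,
    `|st.1 - st.2| < n.+1%:R^-1 & e <= mdist (beta st.1) (beta st.2)].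
  apply: contrapT => H; apply: nd; exists n.+1%:R^-1 => // s t s01 t01 st.
  by rewrite ltNge; apply/negP => est; apply: H; exists (s, t).
have {bad} [st bad] := choice bad.
have := @compact_cluster_seq R^o [set` `[0 : R, 1]] (fun n => (st n).1).
move=> /(_ (@segment_compact _ _ _)) [|z /=].
  by near=> n; have [] := bad n; rewrite /= in_itv.
rewrite in_itv/= => z01 zs.
have [d d0 dH] := bp z z01 _ (divr_gt0 e0 (ltr0n _ 2)).
have [n /= nd2] := zs _ _ (divr_gt0 d0 (ltr0n _ 2)) (invS_lt_near (divr_gt0 d0 (ltr0n _ 2))).
rewrite -ball_mdistE -[ball _ _ _]/(is_true (`|z - (st n).1| < d / 2)) => zn.
have [s01 t01 /lt_trans/(_ nd2) stn] := bad n; apply/negP; rewrite -ltNge.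
have h1 : mdist (beta z) (beta (st n).1) < e / 2 by apply: dH => //; lra.
have h2 : mdist (beta z) (beta (st n).2) < e / 2.
  apply: dH => //; have := ler_distD (st n).1 z (st n).2; lra.
by have := mdistD (beta (st n).1) (beta z) (beta (st n).2);
  rewrite (mdistC _ (beta z)); lra.
Unshelve. all: by end_near. Qed.

End MetricFacts.

(** * Lifting of paths through discrete open maps *)

Section PathLifting.
Context {R : realType}.
Implicit Types X Y : metricType R.

(** A discrete substitute for a lift of [beta]. [K] and [d] are fixed before [beta] and the mesh
    [e], so that chains of ever smaller mesh all lie in one compact set and have limits. *)
Lemma fine_chain X Y (f : X -> Y) (x : X) :
  locally_compact [set: X] -> continuous f -> discrete_map f -> open_map f ->
  exists (K : set X) (d : R), [/\ compact K, 0 < d & forall beta : R -> Y,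
    is_path beta -> beta 0 = f x ->
    (forall t, 0 <= t <= 1 -> mdist (f x) (beta t) < d) ->
    forall e, 0 < e -> exists (N : nat) (u : nat -> X),
    [/\ N.+1%:R^-1 < e, u 0%N = x,
      forall k, (k <= N.+1)%N -> K (u k) /\ f (u k) = beta (k%:R / N.+1%:R) &
      forall k, (k <= N)%N -> mdist (u k) (u k.+1) < e]].
Proof.
move=> lc fc fd fo.
have [K [e0 [cK e0_gt0 e0K]]] := locally_compact_mdist lc x.
have [r [d [/andP[r0 re0] d0 gap]]] := annulus_gap x lc fc fd e0_gt0.
exists K, d; split => // beta bp b0 bd e e_gt0.
(* Steps shorter than [r / 2] cannot jump over the annulus between the radii [r / 2] and [r]. *)
have m0 : 0 < Num.min e (r / 2) by rewrite lt_min e_gt0 divr_gt0.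
have [h h0 lift] := uniformly_open_compact fc fo cK m0.
have [c c0 bc] := is_path_unif bp h0.
have mce : 0 < Num.min c e by rewrite lt_min c0.
have [N /=] := filter_ex (invS_lt_near mce).
rewrite lt_min => /andP[Nc Ne].
(* [next] has to be total for the recursion; the value [x] is a dummy for pairs at which no lift is
   available. *)
have next (up : X * Y) : exists z, K up.1 -> mdist (f up.1) up.2 < h ->
    mdist up.1 z < Num.min e (r / 2) /\ f z = up.2.
  have [Ku|nKu] := pselect (K up.1); last by exists x => /nKu.
  have [fu|nfu] := boolP (mdist (f up.1) up.2 < h); last by exists x.
  by have [z uz fz] := lift _ _ Ku fu; exists z.
have {next} [next nextP] := choice next.
pose u := fix u k := if k is k'.+1 then next (u k', beta (k%:R / N.+1%:R)) else x.
have grid k : (k <= N.+1)%N -> 0 <= (k%:R / N.+1%:R : R) <= 1.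
  by move=> kN; rewrite divr_ge0// ler_pdivrMr// mul1r ler_nat.
have step k : (k <= N)%N -> `|k%:R / N.+1%:R - k.+1%:R / N.+1%:R| < c.
  move=> kN; rewrite -mulrBl -[k.+1%:R]natr1 opprD addrA subrr add0r mulN1r normrN.
  by rewrite gtr0_norm// invr_gt0.
have stay k : (k <= N.+1)%N ->
    mdist x (u k) < r / 2 /\ f (u k) = beta (k%:R / N.+1%:R).
  elim: k => [_|k IH kN]; first by rewrite mul0r b0 /= mdistxx divr_gt0.
  have [xu fu] := IH (ltnW kN).
  have [||uz fz] := nextP (u k, beta (k.+1%:R / N.+1%:R)).
  - by apply: e0K => /=; lra.
  - by rewrite /= fu; apply: bc; [exact/grid/ltnW|exact: grid|exact: step].
  split; last exact: fz.
  move: uz; rewrite lt_min /= => /andP[_ uz].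
  rewrite ltNge; apply/negP => ge_r.
  have := bd _ (grid _ kN); rewrite ltNge -[beta _]fz gap// ge_r /=.
  by have := mdistD x (u k) (next (u k, beta (k.+1%:R / N.+1%:R))); lra.
exists N, u; split => // k kN.
  by have [xu fu] := stay k kN; split => //; apply: e0K; lra.
have [xu fu] := stay k (leqW kN).
have [||+ _] := nextP (u k, beta (k.+1%:R / N.+1%:R)).
- by apply: e0K => /=; lra.
- by rewrite /= fu; apply: bc; [exact/grid/leqW|exact: grid|exact: step].
by rewrite lt_min => /andP[].
Qed.

(* The chain cannot jump over the annulus around [p], whose image avoids the
   ball of radius [d] around [f p]. *)
Lemma trapped_chain X Y (f : X -> Y) (p : X) (r d : R) (u : nat -> X) (i n : nat) :
  (forall v, r / 2 <= mdist p v <= r -> d <= mdist (f p) (f v)) ->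
  (forall k, (k <= n)%N -> mdist (f p) (f (u (i + k)%N)) < d) ->
  (forall k, (k < n)%N -> mdist (u (i + k)%N) (u (i + k).+1) < r / 2) ->
  mdist p (u i) < r / 2 -> mdist p (u (i + n)%N) < r / 2.
Proof.
move=> gap; elim: n => [|n IH] fu su pu; first by rewrite addn0.
have {}IH : mdist p (u (i + n)%N) < r / 2.
  by apply: IH => // k kn; [exact/fu/leqW|exact/su/leqW].
rewrite ltNge; apply/negP => ge_r; have := fu n.+1 (leqnn _).
rewrite ltNge gap// ge_r /= addnS.
by have := mdistD p (u (i + n)%N) (u (i + n).+1); have := su n (leqnn _); lra.
Qed.

(** The same trap for the chain run backwards; continuity of the lift at [t] also concerns times
    before [t]. *)
Lemma trapped_chain_rev X Y (f : X -> Y) (p : X) (r d : R) (u : nat -> X) (i n : nat) :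
  (forall v, r / 2 <= mdist p v <= r -> d <= mdist (f p) (f v)) ->
  (forall k, (k <= n)%N -> mdist (f p) (f (u (i + k)%N)) < d) ->
  (forall k, (k < n)%N -> mdist (u (i + k)%N) (u (i + k).+1) < r / 2) ->
  mdist p (u (i + n)%N) < r / 2 -> mdist p (u i) < r / 2.
Proof.
move=> gap fu su pu.
have := @trapped_chain _ _ f p r d (fun k => u (i + n - k)%N) 0 n gap.
rewrite /= !add0n subn0 addnK; apply => // k kn; rewrite !add0n.
  by rewrite -addnBA//; apply: fu; exact: leq_subr.
rewrite mdistC -addnBA// -addnBA ?(ltnW kn)//.
have -> : (i + (n - k) = (i + (n - k.+1)).+1)%N by rewrite -addnS -subSn// subSS.
by apply: su; rewrite -subSn// subSS leq_subr.
Qed.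

(* The lift is the pointwise limit, along an ultrafilter, of step functions
   following ever finer chains; it is continuous because these chains are
   trapped near [gamma t] as long as their image stays near [beta t]. *)
Lemma local_path_lift X Y (f : X -> Y) (x : X) :
  locally_compact [set: X] -> continuous f -> discrete_map f -> open_map f ->
  exists2 d : R, 0 < d & forall beta : R -> Y, is_path beta -> beta 0 = f x ->
    (forall t, 0 <= t <= 1 -> mdist (f x) (beta t) < d) ->
    exists gamma : R -> X, [/\ is_path gamma, gamma 0 = x &
      forall t, 0 <= t <= 1 -> f (gamma t) = beta t].
Proof.
move=> lc fc fd fo; have [K [d [cK d0 chain]]] := fine_chain x lc fc fd fo.
exists d => // beta bp b0 bd.
have {chain} approx n : exists Nu : nat * (nat -> X),
    [/\ Nu.1.+1%:R^-1 < n.+1%:R^-1 :> R, Nu.2 0%N = x,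
      forall k, (k <= Nu.1.+1)%N ->
        K (Nu.2 k) /\ f (Nu.2 k) = beta (k%:R / Nu.1.+1%:R) &
      forall k, (k <= Nu.1)%N -> mdist (Nu.2 k) (Nu.2 k.+1) < n.+1%:R^-1].
  have [//|N [u H]] := chain beta bp b0 bd n.+1%:R^-1.
  by exists (N, u).
have {approx} [Nu NuP] := choice approx.
pose N n := (Nu n).1.+1; pose u n := (Nu n).2.
pose idx n (t : R) := Num.truncn (t * (N n)%:R).
pose g n (t : R) := u n (idx n t).
have N_gt0 n : 0 < (N n)%:R :> R by rewrite ltr0n.
have idxP n t : 0 <= t <= 1 ->
    [/\ (idx n t <= N n)%N, (idx n t)%:R / (N n)%:R <= t &
        t < (idx n t)%:R / (N n)%:R + (N n)%:R^-1].
  move=> /andP[t0 t1].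
  have /truncn_itv/andP[lo hi] : 0 <= t * (N n)%:R by rewrite mulr_ge0.
  split; last 2 first.
  - by rewrite ler_pdivrMr.
  - by rewrite -[X in _ + X]mul1r -mulrDl natr1 ltr_pdivlMr.
  by rewrite -(ler_nat R) (le_trans lo)// ler_piMl.
have grid n k : (k <= N n)%N -> 0 <= (k%:R / (N n)%:R : R) <= 1.
  by move=> kN; rewrite divr_ge0// ler_pdivrMr// mul1r ler_nat.
have NP n : (N n)%:R^-1 < n.+1%:R^-1 :> R by have [] := NuP n.
have uK n k : (k <= N n)%N -> K (u n k) by have [_ _ H _] := NuP n => /H[].
have fu n k : (k <= N n)%N -> f (u n k) = beta (k%:R / (N n)%:R).
  by have [_ _ H _] := NuP n => /H[].
have us n k : (k < N n)%N -> mdist (u n k) (u n k.+1) < n.+1%:R^-1.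
  by have [_ _ _ H] := NuP n; exact: H.
have u0 n : u n 0%N = x by have [] := NuP n.
clearbody N u; clear NuP.
have [U [UU oU]] := ultraFilterLemma eventually_filter.
have lim t : exists z, 0 <= t <= 1 ->
    forall e : R, 0 < e -> \forall n \near U, mdist z (g n t) < e.
  have [t01|nt] := boolP (0 <= t <= 1); last by exists x.
  have [|z Kz zg] := compact_ultralimit (u := fun n => g n t) cK UU.
    by apply: filterE => n; have [iN _ _] := idxP n t t01; exact: uK.
  by exists z.
have {lim} [gamma lim] := choice lim.
have fgamma t : 0 <= t <= 1 -> f (gamma t) = beta t.
  move=> t01; apply/mdist_positivity/eqP; rewrite eq_le mdist_ge0 andbT.
  apply: (@ler_addMeps _ _ _ 2) => // a a0; rewrite add0r.
  have [b b0' bH] := (continuous_mdistP f (gamma t)).1 (fc _) _ a0.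
  have [c c0 cH] := (is_pathP beta).1 bp t t01 a a0.
  have [n [/= /bH ga nc]] :=
    filter_ex (filterI (lim t t01 b b0') (oU _ (invS_lt_near c0))).
  have [iN lo hi] := idxP n t t01.
  have : mdist (beta t) (f (g n t)) < a.
    rewrite /g fu//; apply: cH; first exact: grid.
    have := lt_trans (NP n) nc.
    by rewrite ltr_norml => ?; apply/andP; split; lra.
  by have := mdistD (f (gamma t)) (f (g n t)) (beta t);
    rewrite (mdistC (f (g n t))); lra.
exists gamma; split => //; last first.
  have z01 : 0 <= (0 : R) <= 1 by rewrite lexx ler01.
  apply/mdist_positivity/eqP; rewrite eq_le mdist_ge0 andbT.
  apply/ler_addgt0Pr => e e0; rewrite add0r.
  have [n] := filter_ex (lim 0 z01 e e0).
  rewrite /g /idx mul0r truncn0 u0; exact: ltW.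
apply/is_pathP => t t01 e e0; pose p := gamma t.
have [r [c [/andP[r0 re] c0 gap]]] := annulus_gap p lc fc fd e0.
have [a a0 aH] := (is_pathP beta).1 bp t t01 c c0.
exists (a / 2); first by rewrite divr_gt0.
move=> s s01 ts; move: ts; rewrite ltr_norml => /andP[ts1 ts2].
have r2 : 0 < r / 2 by rewrite divr_gt0.
have a2 : 0 < a / 2 by rewrite divr_gt0.
(* One [n] meets all demands: [g n] is within [r / 2] of [gamma] at both [t] and [s], chain steps
   are below [r / 2], and the grid mesh is below [a / 2]. *)
have [n [/= [pg sg] [nr na]]] := filter_ex (filterI
  (filterI (lim t t01 _ r2) (lim s s01 _ r2))
  (oU _ (filterI (invS_lt_near r2) (invS_lt_near a2)))).
have {}na := lt_trans (NP n) na.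
have [iN ilo ihi] := idxP n t t01; have [jN jlo jhi] := idxP n s s01.
(* Grid times with these indices differ from [t] by less than [|t - s|] plus the mesh, hence by less
   than [a], so their images stay inside the gap around [f p]. *)
have between k : (minn (idx n t) (idx n s) <= k)%N ->
    (k <= maxn (idx n t) (idx n s))%N ->
    (k <= N n)%N /\ mdist (f p) (f (u n k)) < c.
  rewrite geq_min leq_max => lo hi.
  have kN : (k <= N n)%N by case/orP: hi => /leq_trans; apply.
  split => //; rewrite fgamma// fu//; apply: aH; first exact: grid.
  have divle (l m : nat) : (l <= m)%N -> l%:R / (N n)%:R <= m%:R / (N n)%:R :> R.
    by move=> lm; rewrite ler_pM2r ?invr_gt0// ler_nat.
  rewrite ltr_norml; apply/andP; split;
    by case/orP: lo => /divle lo; case/orP: hi => /divle hi; lra.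
have ps : mdist p (g n s) < r / 2.
  have [ij|/ltnW ji] := leqP (idx n t) (idx n s).
    rewrite (minn_idPl ij) (maxn_idPr ij) in between.
    rewrite /g -(subnKC ij); apply: (trapped_chain gap) => // k.
      by rewrite leq_subRL// => /(between _ (leq_addr _ _))[].
    rewrite ltn_subRL => kj; by apply: lt_trans nr; apply: us; exact: leq_trans kj jN.
  rewrite (minn_idPr ji) (maxn_idPl ji) in between.
  apply: (trapped_chain_rev (i := idx n s) (n := idx n t - idx n s) gap) => [k|k|].
  - by rewrite leq_subRL// => /(between _ (leq_addr _ _))[].
  - by rewrite ltn_subRL => ki; apply: lt_trans nr; apply: us; exact: leq_trans ki iN.
  - by rewrite subnKC.
have := mdistD p (g n s) (gamma s); rewrite (mdistC (g n s)); lra.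
Qed.

End PathLifting.

(** * Length, and the co-Lipschitz property of BLD maps *)

Section PathLength.
Context {R : realType}.
Implicit Types X Y : metricType R.

(** A recursive form of [polygonal_length] with a free starting point, suited to induction on
    partitions. *)
Fixpoint chain_length X (gamma : R -> X) (a : R) (s : seq R) : R :=
  if s is b :: s' then mdist (gamma a) (gamma b) + chain_length gamma b s'
  else 0.

Lemma polygonal_lengthE X (gamma : R -> X) s :
  polygonal_length gamma s = chain_length gamma 0 s.
Proof.
suff H a : \sum_(0 <= n < size s)
    mdist (gamma (nth 1 (a :: s) n)) (gamma (nth 1 s n)) =
    chain_length gamma a s by exact: H.
elim: s a => [|b s IH] a /=.
  by rewrite big_geq.
by rewrite big_nat_recl//= -IH.
Qed.

Lemma chain_length_cat X (gamma : R -> X) a s t :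
  chain_length gamma a (s ++ t) =
  chain_length gamma a s + chain_length gamma (last a s) t.
Proof. by elim: s a => [a|b s IH a] /=; rewrite ?add0r// IH addrA. Qed.

Lemma le_path_length X (gamma : R -> X) s : itv_partition 0 1 s ->
  ((chain_length gamma 0 s)%:E <= path_length gamma)%E.
Proof.
by move=> ps; apply: ereal_sup_ubound; exists s => //; rewrite polygonal_lengthE.
Qed.

Lemma path_length_le X (gamma : R -> X) M :
  (forall s, itv_partition 0 1 s -> ((chain_length gamma 0 s)%:E <= M)%E) ->
  (path_length gamma <= M)%E.
Proof.
by move=> H; apply: ge_ereal_sup => _ [s ps <-]; rewrite polygonal_lengthE H.
Qed.

Lemma mdist_le_path_length X (gamma : R -> X) t : 0 <= t <= 1 ->
  ((mdist (gamma 0) (gamma t) + mdist (gamma t) (gamma 1))%:E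
    <= path_length gamma)%E.
Proof.
(* Partitions increase strictly, so [t = 0] and [t = 1] are reduced to the partition with the single
   step from 0 to 1. *)
move=> /andP[]; rewrite (le_eqVlt 0 t) (le_eqVlt t 1).
have one : ((mdist (gamma 0) (gamma 1))%:E <= path_length gamma)%E.
  have := le_path_length gamma (itv_partition1 (@ltr01 R)).
  by rewrite /= addr0.
move=> /predU1P[<- _|t0]; first by rewrite mdistxx add0r.
move=> /predU1P[->|t1]; first by rewrite mdistxx addr0.
have := @le_path_length _ gamma [:: t; 1].
by rewrite /= addr0; apply; rewrite /itv_partition /= t0 t1.
Qed.

Lemma eq_chain_length X (gamma gamma' : R -> X) a b s :
  itv_partition a b s -> (forall t, a <= t <= b -> gamma t = gamma' t) ->
  chain_length gamma a s = chain_length gamma' a s.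
Proof.
elim: s a => [//|c s IH a ps eqg] /=.
have ac : a <= c by have [/= /andP[/ltW ? _] _] := ps.
have cb : c <= b by exact: itv_partition_le (itv_partition_cons ps).
rewrite !eqg ?lexx ?ac ?(le_trans ac)// (IH c (itv_partition_cons ps))// => t.
by move=> /andP[ct tb]; apply: eqg; rewrite (le_trans ac).
Qed.

Lemma eq_path_length X (gamma gamma' : R -> X) :
  (forall t, 0 <= t <= 1 -> gamma t = gamma' t) ->
  path_length gamma = path_length gamma'.
Proof.
move=> eqg; apply/eqP; rewrite eq_le; apply/andP; split;
  apply: path_length_le => s ps.
  by rewrite (eq_chain_length ps eqg) le_path_length.
by rewrite -(eq_chain_length ps eqg) le_path_length.
Qed.

Lemma path_length_lipschitz X Y (f : X -> Y) (L : R) (gamma : R -> X) : 0 < L ->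
  (forall x y, mdist (f x) (f y) <= L * mdist x y) ->
  (path_length (f \o gamma) <= L%:E * path_length gamma)%E.
Proof.
move=> L0 fL; apply: path_length_le => s ps.
apply: (@le_trans _ _ (L * chain_length gamma 0 s)%:E).
  rewrite lee_fin; elim: s 0 {ps} => [a|b s IH a] /=; first by rewrite mulr0.
  by rewrite mulrDr lerD.
by rewrite EFinM lee_pmul2l// ?lte_fin// le_path_length.
Qed.

Lemma short_path X (x y : X) (c : R) : path_metric_space X -> mdist x y < c ->
  exists gamma : R -> X, [/\ is_path gamma, gamma 0 = x, gamma 1 = y &
    (path_length gamma < c%:E)%E].
Proof.
move=> pX; rewrite -lte_fin pX => /ereal_inf_lt[_ [gamma [gp g0 g1] <-] gc].
by exists gamma.
Qed.

Lemma BLD_lipschitz X Y (f : X -> Y) (L : R) : 0 < L ->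
  path_metric_space X -> BLD L f ->
  forall x y, mdist (f x) (f y) <= L * mdist x y.
Proof.
move=> L0 pX [_ fL] x y; apply: (ler_addMeps L0) => e e0.
have [|gamma [gp g0 g1 gl]] := @short_path X x y (mdist x y + e) pX.
  by rewrite ltrDl.
rewrite -mulrDr -lee_fin.
have := @mdist_le_path_length _ (f \o gamma) 1; rewrite lexx ler01 => /(_ isT).
rewrite mdistxx addr0 /= g0 g1 => /le_trans; apply.
have [_ /le_trans] := fL gamma gp; apply.
by rewrite EFinM lee_pmul2l// ?lte_fin// ltW.
Qed.

(** A path from [f x] to [y] of length below [c <= r] stays where lifting is possible, and the lower
    BLD bound makes its lift shorter than [L * c]. *)
Lemma BLD_colipschitz_near X Y (f : X -> Y) (L : R) : 0 < L ->
  locally_compact [set: X] -> path_metric_space Y -> BLD L f ->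
  forall x, exists2 r : R, 0 < r & forall y c, mdist (f x) y < c -> c <= r ->
    exists2 z, f z = y & mdist x z < L * c.
Proof.
move=> L0 lc pY [[fc fd fo] fL] x.
have [r r0 lift] := local_path_lift x lc fc fd fo.
exists r => // y c yc cr.
have [beta [bp b0 b1 bl]] := short_path pY yc.
have near t : 0 <= t <= 1 -> mdist (f x) (beta t) < r.
  move=> /mdist_le_path_length-/(_ _ beta)/le_lt_trans/(_ bl).
  rewrite lte_fin b0 => H; apply: lt_le_trans cr; apply: le_lt_trans H.
  by rewrite lerDl mdist_ge0.
have [gamma [gp g0 fg]] := lift beta bp b0 near.
exists (gamma 1); first by rewrite fg ?lexx ?ler01.
have [+ _] := fL gamma gp.
rewrite (eq_path_length (gamma' := beta))// lee_pdivrMl// -lte_fin => gl.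
have := @mdist_le_path_length _ gamma 1; rewrite lexx ler01 => /(_ isT).
rewrite mdistxx addr0 g0 => /le_lt_trans; apply.
by apply: le_lt_trans gl _; rewrite EFinM lte_pmul2l// lte_fin.
Qed.

Lemma continuous_mdist X (a : X) : continuous (mdist a : X -> R).
Proof.
move=> x; apply/cvgrPdist_lt => e e0; apply/nbhs_mdistP; exists e => // y xy.
have := mdistD a x y; have := mdistD a y x; rewrite (mdistC y) => h1 h2.
by rewrite ltr_norml; apply/andP; split; lra.
Qed.

(* Caristi's fixed point argument, for the order [mdist z w <= K (phi z - phi w)]. *)
Lemma descent X (phi : X -> R) (K : R) : complete_space X -> 0 < K ->
  continuous phi -> (forall z, 0 <= phi z) ->
  (forall z, 0 < phi z ->
    exists2 w, phi w < phi z & mdist z w <= K * (phi z - phi w)) ->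
  forall x, exists2 z, phi z = 0 & mdist x z <= K * phi x.
Proof.
move=> cX K0 phic phi0 step x.
pose below z w := mdist z w <= K * (phi z - phi w).
have below_trans z w v : below z w -> below w v -> below z v.
  rewrite /below => zw wv; have := mdistD z w v; nra.
have belowxx z : below z z by rewrite /below mdistxx subrr mulr0.
(* A greedy choice: passing from [z] to [w] realises at least half of the decrease of [phi]
   attainable below [z]. *)
have half z : exists w, below z w /\ forall v, below z v -> 2 * phi w <= phi z + phi v.
  pose S := phi @` below z.
  have S0 : S !=set0 by exists (phi z), z.
  have Slb : has_lbound S by exists 0 => _ [w _ <-].
  have infz : inf S <= phi z by apply: ge_inf => //; exists z.
  have lbS v : below z v -> inf S <= phi v by move=> zv; apply: ge_inf => //; exists v.
  move: infz; rewrite le_eqVlt => /predU1P[zinf|zinf].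
    by exists z; split => // v /lbS; lra.
  have gap_gt0 : 0 < (phi z - inf S) / 2 by rewrite divr_gt0// subr_gt0.
  have [_ [w zw <-]] := inf_adherent gap_gt0 (conj S0 Slb).
  by move=> wS; exists w; split => // v /lbS; lra.
have {half} [next nextP] := choice half.
pose u n := iter n next x.
have phiS n : phi (u n.+1) <= phi (u n).
  have [+ _] := nextP (u n); rewrite /below -/(u n.+1) => H.
  have := mdist_ge0 (u n) (u n.+1); nra.
have ubelow n m : (n <= m)%N -> below (u n) (u m).
  move=> /subnKC <-; elim: (m - n)%N => [|k IH]; first by rewrite addn0.
  by rewrite addnS; apply: (below_trans _ _ _ IH); have [] := nextP (u (n + k)%N).
have phi_dec : {homo phi \o u : n m / (n <= m)%N >-> m <= n}.
  by apply/nonincreasing_seqP => n /=; exact: phiS.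
have phi_cvg : cvgn (phi \o u).
  apply: nonincreasing_is_cvgn => //.
  by exists 0 => _ [n _ <-]; exact: phi0.
set m := limn (phi \o u) in phi_cvg.
have phi_ge n : m <= phi (u n) by exact: nonincreasing_cvgn_ge.
have phi_near (e : R) : 0 < e -> \forall n \near \oo, phi (u n) < m + e.
  move=> e0; have /cvgrPdist_lt/(_ e e0) := phi_cvg.
  by apply: filterS => n /=; rewrite ltr_norml => /andP[]; lra.
have ucauchy : cauchy (u @ \oo).
  apply: cauchy_exP => e e0.
  have [N _ HN] := phi_near _ (divr_gt0 e0 K0).
  exists (u N); exists N => // n /= Nn; rewrite ball_mdistE.
  apply: le_lt_trans (ubelow _ _ Nn) _.
  have := HN N (leqnn _); have := phi_ge n => /= h1 h2.
  by rewrite mulrC -ltr_pdivlMr//; lra.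
have [l ul] := cX u ucauchy.
have phil : phi l = m.
  apply/esym/cvg_lim => //; apply: continuous_cvg => //; exact: phic.
have l_below n : below (u n) l.
  rewrite /below phil; apply: (@ler_addMeps _ _ _ 1) => // e e0; rewrite mul1r.
  have [k [/= kl nk]] := filter_ex
    (filterI ((cvg_mdistP _ _ _).1 ul e e0) (nbhs_infty_ge n)).
  have := mdistD (u n) (u k) l; rewrite (mdistC (u k)).
  have := ubelow n k nk; rewrite /below; have := phi_ge k; nra.
exists l; last by apply: le_trans (l_below 0%N) _; have := phi0 l; rewrite /=; nra.
(* A point [v] below [l] with [phi v < m] is below every [u n], so the greedy choice gives
   [2 * phi (u n.+1) <= phi (u n) + phi v], which is less than [2 * m] for large [n]. *)
apply/eqP; rewrite eq_le phi0 andbT leNgt; apply/negP => l0.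
have [v vl lv] := step l l0.
have lv_gt0 : 0 < phi l - phi v by rewrite subr_gt0.
have [n /= nH] := filter_ex (phi_near _ lv_gt0).
have [_ /(_ v (below_trans _ _ _ (l_below n) lv))] := nextP (u n).
have := phi_ge n.+1; rewrite -/(u n.+1); lra.
Qed.

Lemma sphere_on_path X (sigma : R -> X) (r : R) : is_path sigma ->
  0 <= r <= mdist (sigma 0) (sigma 1) ->
  exists2 t, 0 <= t <= 1 & mdist (sigma 0) (sigma t) = r.
Proof.
move=> sp r01.
have [||t] := @IVT R (mdist (sigma 0) \o sigma) 0 1 r ler01.
- move=> t; apply: (@continuous_comp (subspace [set` `[0 : R, 1]]) X R).
    exact: sp.
  exact: continuous_mdist.
- by rewrite /= mdistxx (min_idPl (mdist_ge0 _ _)) (max_idPr (mdist_ge0 _ _)).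
by rewrite in_itv; exists t.
Qed.

(** [descent] is applied to the distance from [f z] to [y]: while it is positive, a short move of
    [z] brings [f z] closer along an almost shortest path. *)
Lemma colipschitz_near_global X Y (f : X -> Y) (L : R) : 0 < L ->
  complete_space X -> path_metric_space Y -> continuous f ->
  (forall x, exists2 r : R, 0 < r & forall y c, mdist (f x) y < c -> c <= r ->
    exists2 z, f z = y & mdist x z < L * c) ->
  forall x y c, L * mdist (f x) y < c -> exists2 z, f z = y & mdist x z < c.
Proof.
move=> L0 cX pY fc loc x y c xyc.
have [d0|d0] := eqVneq (mdist (f x) y) 0.
  exists x; first exact: mdist_positivity.
  by move: xyc; rewrite d0 mulr0 mdistxx.
have {}d0 : 0 < mdist (f x) y by rewrite lt_neqAle eq_sym d0 mdist_ge0.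
set d := mdist (f x) y in xyc d0.
(* [K > L] leaves room for the errors of a single move, and [K * d < c] gives the final bound. *)
pose K := (L + c / d) / 2.
have LK : L < K by have : L < c / d; [rewrite ltr_pdivlMr|rewrite /K; lra].
have Kd : K * d = (L * d + c) / 2 by rewrite /K; field; rewrite gt_eqF.
have K0 : 0 < K by exact: lt_trans LK.
have [||z phz|z /mdist_positivity fz xz] :=
    @descent X (fun z => mdist y (f z)) K cX K0 _ _ _ x; last first.
- exists z; first exact/esym.
  by apply: le_lt_trans xz _; rewrite mdistC -/d Kd; lra.
- have [r r0 rH] := loc z; set D := mdist y (f z) in phz *.
  (* [tau] is the distance advanced from [f z], [eta] the excess length of the path. The move costs
     less than [L * (tau + eta)] and gains more than [tau - eta]; the bound on [eta] makes the cost
     at most [K] times the gain, and [tau + eta <= r] keeps the move local. *)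
  pose tau := Num.min (r / 2) D.
  have tau0 : 0 < tau by rewrite lt_min divr_gt0.
  have [taur tauD] : tau <= r / 2 /\ tau <= D by rewrite !ge_min !lexx orbT.
  pose eta := Num.min (r / 2) (tau * ((K - L) / (K + L))).
  have q0 : 0 < (K - L) / (K + L) by rewrite divr_gt0 ?subr_gt0 ?addr_gt0.
  have eta0 : 0 < eta by rewrite lt_min divr_gt0// mulr_gt0.
  have [etar etaq] : eta <= r / 2 /\ eta <= tau * ((K - L) / (K + L)).
    by rewrite !ge_min !lexx orbT.
  have etaK : L * (tau + eta) <= K * (tau - eta).
    have : (K + L) * eta <= tau * (K - L).
      have -> : tau * (K - L) = (K + L) * (tau * ((K - L) / (K + L))).
        by field; rewrite gt_eqF// addr_gt0.
      by rewrite ler_pM2l// addr_gt0.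
    lra.
  have etatau : eta < tau.
    have : 0 < L * (tau + eta) by rewrite mulr_gt0// addr_gt0.
    by move=> /lt_le_trans/(_ etaK); rewrite pmulr_rgt0// subr_gt0.
  have [|sigma [sp s0 s1 sl]] := @short_path Y (f z) y (D + eta) pY.
    by rewrite mdistC ltrDl.
  have [|t t01 st] := @sphere_on_path Y sigma tau sp.
    by rewrite s0 s1 mdistC -/D tauD ltW.
  have := mdist_le_path_length sigma t01.
  rewrite st s1 => /le_lt_trans/(_ sl); rewrite lte_fin => sD.
  have [||w fw zw] := rH (sigma t) (tau + eta).
  - by rewrite -s0 st ltrDl.
  - by lra.
  have wD : mdist y (f w) < D + eta - tau by rewrite fw mdistC; lra.
  exists w; first by lra.
  apply: le_trans (ltW zw) _; apply: le_trans etaK _.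
  by rewrite ler_pM2l//; lra.
- by move=> z; exact: mdist_ge0.
- by move=> z; apply: continuous_comp; [exact: fc|exact: continuous_mdist].
Qed.

Lemma BLD_colipschitz X Y (f : X -> Y) (L : R) : 0 < L ->
  locally_compact [set: X] -> complete_space X -> path_metric_space Y ->
  BLD L f ->
  forall x y c, L * mdist (f x) y < c -> exists2 z, f z = y & mdist x z < c.
Proof.
move=> L0 lc cX pY fL; apply: colipschitz_near_global => //.
  by have [[]] := fL.
exact: BLD_colipschitz_near fL.
Qed.

End PathLength.

(** * Discrete Lipschitz quotients are BLD *)

Section LocalExpansion.
Context {R : realType}.
Implicit Types X Y : metricType R.

(** Let [S] be the set of points that [T] reaches from [a]. At its supremum, the left half of the
    local hypothesis shows that the supremum is reached, the right half that it cannot lie before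
    [b]. *)
Lemma interval_induction (T : R -> R -> Prop) :
  (forall a b c, T a b -> T b c -> T a c) ->
  (forall t, 0 <= t <= 1 -> exists2 d : R, 0 < d & forall s, 0 <= s <= 1 ->
     `|t - s| < d -> (s <= t -> T s t) /\ (t <= s -> T t s)) ->
  forall a b, 0 <= a -> a <= b -> b <= 1 -> T a b.
Proof.
move=> Ttrans Tloc a b a0 ab b1.
pose S := [set c | [/\ a <= c, c <= b & T a c]].
have Taa : T a a.
  have [|d d0 H] := Tloc a; first by rewrite a0 (le_trans ab).
  have [||+ _] := H a; first by rewrite a0 (le_trans ab).
    by rewrite subrr normr0.
  exact.
have Sa : S a by [].
have Sub : has_ubound S by exists b => c [].
have supS : has_sup S by split; [exists a|].
have a_sup : a <= sup S by exact: ub_le_sup.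
have sup_b : sup S <= b by apply: ge_sup; [exists a|move=> c []].
have sup01 : 0 <= sup S <= 1 by rewrite (le_trans a0)// (le_trans sup_b).
have [d d0 H] := Tloc _ sup01.
have [c Sc dc] := sup_adherent d0 supS.
have c_sup : c <= sup S by exact: ub_le_sup.
have [ac cb Tac] := Sc.
have Tasup : T a (sup S).
  have [||Tcs _] := H c; first by apply/andP; split; lra.
    by rewrite ltr_norml; apply/andP; split; lra.
  exact: Ttrans Tac (Tcs c_sup).
move: sup_b; rewrite le_eqVlt => /predU1P[<-//|sup_b].
have [e [e0 eb ed]] : exists e : R, [/\ 0 < e, sup S + e <= b & e < d].
  exists (Num.min (b - sup S) (d / 2)); split.
  - by rewrite lt_min subr_gt0 sup_b divr_gt0.
  - by rewrite -lerBrDl ge_min lexx.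
  - by rewrite gt_min; apply/orP; right; lra.
have [||_ Tse] := H (sup S + e); first by apply/andP; split; lra.
  by rewrite opprD addNKr normrN gtr0_norm.
have /(ub_le_sup Sub) : S (sup S + e).
  by split; [lra|lra|apply: Ttrans Tasup (Tse _); lra].
lra.
Qed.

Lemma path_length_locally_expanding X Y (f : X -> Y) (L : R) (gamma : R -> X) :
  0 < L ->
  (forall t, 0 <= t <= 1 -> exists2 d : R, 0 < d &
    forall s, 0 <= s <= 1 -> `|t - s| < d ->
    mdist (gamma t) (gamma s) <= L * mdist (f (gamma t)) (f (gamma s))) ->
  (L^-1%:E * path_length gamma <= path_length (f \o gamma))%E.
Proof.
move=> L0 loc.
(* The existential partition makes [T] transitive by the triangle inequality, although the expansion
   bound compares [t] only with points near [t]. *)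
pose T a b := exists2 s, itv_partition a b s &
  mdist (gamma a) (gamma b) <= L * chain_length (f \o gamma) a s.
have Ttrans a b c : T a b -> T b c -> T a c.
  move=> [s ps ls] [t pt lt]; exists (s ++ t); first exact: itv_partition_cat ps pt.
  have [_ /eqP lastb] := ps.
  rewrite chain_length_cat lastb mulrDr.
  by have := mdistD (gamma a) (gamma b) (gamma c); lra.
have Tle a b : a <= b ->
    mdist (gamma a) (gamma b) <= L * mdist (f (gamma a)) (f (gamma b)) -> T a b.
  rewrite le_eqVlt => /predU1P[<- _|ab lab].
    by exists [::] => //=; rewrite mdistxx mulr0.
  by exists [:: b]; [exact: itv_partition1|rewrite /= addr0].
have refine : forall a b, 0 <= a -> a <= b -> b <= 1 -> T a b.
  apply: interval_induction => // t /loc[d d0 H]; exists d => // s s01 ts.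
  have := H s s01 ts; split=> st; apply: Tle => //.
  by rewrite mdistC (mdistC (f _)).
have {}refine s a : 0 <= a -> itv_partition a 1 s -> exists2 s',
    itv_partition a 1 s' &
    chain_length gamma a s <= L * chain_length (f \o gamma) a s'.
  elim: s a => [a _ ps|b s IH a a0 ps].
    by exists [::] => //=; rewrite mulr0.
  have ab : a <= b by have [/= /andP[/ltW ? _] _] := ps.
  have ps' := itv_partition_cons ps.
  have [s1 ps1 ls1] := refine a b a0 ab (itv_partition_le ps').
  have [s2 ps2 ls2] := IH b (le_trans a0 ab) ps'.
  exists (s1 ++ s2); first exact: itv_partition_cat ps1 ps2.
  have [_ /eqP lastb] := ps1.
  by rewrite chain_length_cat lastb mulrDr /=; lra.
rewrite lee_pdivrMl//; apply: path_length_le => s ps.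
have [s' ps' ss'] := refine s 0 (lexx _) ps.
apply: le_trans (_ : (L * chain_length (f \o gamma) 0 s')%:E <= _)%E.
  by rewrite lee_fin.
by rewrite EFinM lee_pmul2l// ?lte_fin// le_path_length.
Qed.

(** The radius [r] serves all centres [a] near [x], and the bound on [mdist a z] is not strict, as
    it is obtained for limits of points. *)
Definition colipschitz_near X Y (L : R) (f : X -> Y) (x : X) :=
  exists2 r : R, 0 < r & forall a, mdist x a < r -> forall c, 0 < c < r ->
    forall y, L * mdist (f a) y < c -> exists2 z, f z = y & mdist a z <= c.

Lemma colipschitz_open X Y (f : X -> Y) (L : R) : 0 < L ->
  (forall x, colipschitz_near L f x) -> open_map f.
Proof.
move=> L0 loc U oU; rewrite openE => _ [x Ux <-]; apply/nbhs_mdistP.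
have /nbhs_mdistP[e e0 eU] : nbhs x U by exact: open_nbhs_nbhs.
have [r r0 H] := loc x.
pose c := Num.min (r / 2) (e / 2).
have c0 : 0 < c by rewrite lt_min !divr_gt0.
have [cr ce] : c <= r / 2 /\ c <= e / 2 by rewrite !ge_min !lexx orbT.
exists (c / L); first by rewrite divr_gt0.
move=> y; rewrite ltr_pdivlMr// mulrC => yc.
have [||z fz xz] := H x _ c _ y yc.
- by rewrite mdistxx.
- by rewrite c0; lra.
by exists z => //; apply: eU; lra.
Qed.

(* The point of the fibre of [f x] that co-Lipschitz continuity provides near
   [a] can only be [x] itself. *)
Lemma colipschitz_discrete_expanding X Y (f : X -> Y) (L : R) (x : X) : 0 < L ->
  discrete_map f -> colipschitz_near L f x ->
  exists2 d : R, 0 < d & forall a, mdist x a < d ->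
    mdist x a <= L * mdist (f x) (f a).
Proof.
move=> L0 fd [r r0 H].
have [i i0 iH] := @discrete_mdist _ X _ x (fd (f x)) erefl.
pose d := Num.min r (i / 2).
have d0 : 0 < d by rewrite lt_min r0 divr_gt0.
have [dr di] : d <= r /\ d <= i / 2 by rewrite !ge_min !lexx orbT.
exists d => // a xa; rewrite leNgt; apply/negP => lt.
(* Any [c] strictly between the two sides of the failing inequality leads to a contradiction; the
   midpoint is taken. *)
have [c [c0 cd lc ca]] : exists c : R,
    [/\ 0 < c, c < d, L * mdist (f x) (f a) < c & c < mdist x a].
  exists ((L * mdist (f x) (f a) + mdist x a) / 2).
  have : 0 <= L * mdist (f x) (f a) by rewrite mulr_ge0 ?mdist_ge0// ltW.
  by split; lra.
have [|||z fz az] := H a _ c _ (f x).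
- by lra.
- by rewrite c0; lra.
- by rewrite mdistC.
have zx : z = x by apply: iH => //; have := mdistD x a z; lra.
by move: az; rewrite zx mdistC; lra.
Qed.

Lemma discrete_lipschitz_quotient_BLD X Y (f : X -> Y) (L : R) : 0 < L ->
  continuous f -> discrete_map f ->
  (forall x y, mdist (f x) (f y) <= L * mdist x y) ->
  (forall x, colipschitz_near L f x) -> BLD L f.
Proof.
move=> L0 fc fd fL loc; split.
  by split => //; exact: colipschitz_open loc.
move=> gamma gp; split; last exact: path_length_lipschitz.
apply: path_length_locally_expanding => // t t01.
have [d d0 H] := colipschitz_discrete_expanding L0 fd (loc (gamma t)).
have [c c0 cH] := (is_pathP gamma).1 gp t t01 d d0.
by exists c => // s s01 ts; apply: H; exact: cH.
Qed.

End LocalExpansion.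

(** * Limits of mapping packages *)

Section Limit.
Context {R : realType}.

(** What convergence yields at one fixed radius, with the errors [eps] absorbed into eventual
    statements. *)
Definition asymptotic_isometry (X : nat -> metricType R) (X0 : metricType R)
    (x : forall i, X i) (x0 : X0) (r : R) (g : forall i, X i -> X0) :=
  [/\ forall i, g i (x i) = x0,
      forall e : R, 0 < e -> \forall i \near \oo, forall u v,
        mdist (x i) u < r -> mdist (x i) v < r ->
        `|mdist (g i u) (g i v) - mdist u v| < e &
      forall a, mdist x0 a < r -> exists2 a_ : forall i, X i,
        forall i, mdist (x i) (a_ i) < r &
        g i (a_ i) @[i --> \oo] --> a].

Lemma gh_asymptotic_isometry (X : nat -> metricType R) (X0 : metricType R)
    (x : forall i, X i) (x0 : X0) (r : R) (e : nat -> R)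
    (g : forall i, X i -> X0) :
  0 < r -> (forall i, 0 < e i) -> e i @[i --> \oo] --> (0 : R) ->
  (forall i, gh_approximation (x i) x0 r (e i) (g i)) ->
  asymptotic_isometry x x0 r g.
Proof.
move=> r0 e0 ecvg gh.
have e_near (c : R) : 0 < c -> \forall i \near \oo, e i < c.
  move=> c0; have /cvgrPdist_lt/(_ c c0) := ecvg.
  by apply: filterS => i; rewrite sub0r normrN gtr0_norm.
split=> [i|c c0|a xa].
- by have [] := gh i.
- have ri : 0 < r^-1 by rewrite invr_gt0.
  near=> i => u v xu xv; have [[_ qi _] _ _] := gh i.
  (* For large [i] the ball of radius [(e i)^-1] contains the ball of radius [r], so the distance
     estimate covers all of the latter. *)
  have rei : r <= (e i)^-1.
    rewrite -[r]invrK lef_pV2 ?posrE//; apply: ltW; near: i; exact: e_near.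
  apply: (@lt_trans _ _ (e i)); last by near: i; exact: e_near.
  by apply: qi; split; rewrite ball_mdistE//; apply: lt_le_trans rei.
(* The base point fills in for those [i] at which [a] is not yet in the ball of radius [r - e i]. *)
- have ex i : exists u, mdist (x i) u < r /\
      (mdist x0 a < r - e i -> mdist a (g i u) < e i).
    have [are|nare] := boolP (mdist x0 a < r - e i); last first.
      by exists (x i); rewrite mdistxx.
    have [_ _ sub] := gh i.
    have := sub a; rewrite ball_mdistE => /(_ are)/ereal_inf_lt.
    move=> [_ [_ [u xu <-] <-]]; rewrite lte_fin => au.
    by exists u; rewrite -ball_mdistE.
  exists (fun i => sval (cid (ex i))) => [i|]; first by case: cid => u [].
  apply/cvg_mdistP => c c0; near=> i.
  case: cid => u [_ /= H]; apply: (@lt_trans _ _ (e i)); last first.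
    by near: i; exact: e_near.
  apply: H; rewrite ltrBrDr addrC -ltrBrDr; near: i; apply: e_near.
  by rewrite subr_gt0.
Unshelve. all: by end_near. Qed.

(** The convergence of images in (GH-ii) requires them to lie eventually in the ball of radius [r];
    the Lipschitz bound and [L * mdist (pkg_dom_base Q) a < r] ensure this. *)
Lemma package_cvg_asymptotic (P : nat -> mapping_package R)
    (Q : mapping_package R) (L r : R) : 1 <= L -> 0 < r ->
  (forall i u v, mdist (@pkg_map R (P i) u) (@pkg_map R (P i) v) <= L * mdist u v) ->
  package_cvg P Q ->
  exists (g : forall i, pkg_dom (P i) -> pkg_dom Q)
         (h : forall i, pkg_cod (P i) -> pkg_cod Q),
  [/\ asymptotic_isometry (fun i => pkg_dom_base (P i)) (pkg_dom_base Q) r g,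
      asymptotic_isometry (fun i => pkg_cod_base (P i)) (pkg_cod_base Q) r h &
      forall a a_, L * mdist (pkg_dom_base Q) a < r ->
        (forall i, mdist (pkg_dom_base (P i)) (a_ i) < r) ->
        g i (a_ i) @[i --> \oo] --> a ->
        (\forall i \near \oo,
          mdist (pkg_cod_base (P i)) (pkg_map (a_ i)) < r) /\
        h i (pkg_map (a_ i)) @[i --> \oo] --> pkg_map a].
Proof.
move=> L1 r0 fL [eps [g [h [gh ghii]]]].
have L0 : 0 < L by exact: lt_le_trans L1.
have [e0 ecvg ghg ghh] := gh r r0.
have ag := gh_asymptotic_isometry r0 e0 ecvg ghg.
have ah := gh_asymptotic_isometry r0 e0 ecvg ghh.
exists (g r), (h r); split => // a a_ Lar a_r a_a.
have fa_r : \forall i \near \oo, mdist (pkg_cod_base (P i)) (pkg_map (a_ i)) < r.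
  have [gx gd _] := ag.
  pose e := (r - L * mdist (pkg_dom_base Q) a) / (2 * L).
  have e_gt0 : 0 < e by rewrite divr_gt0 ?subr_gt0// mulr_gt0.
  have Le : L * (2 * e) = r - L * mdist (pkg_dom_base Q) a.
    by rewrite /e; field; rewrite gt_eqF.
  near=> i.
  have ga : mdist a (g r i (a_ i)) < e.
    by near: i; exact: (cvg_mdistP _ _ _).1.
  have gdi : forall u v, mdist (pkg_dom_base (P i)) u < r ->
      mdist (pkg_dom_base (P i)) v < r ->
      `|mdist (g r i u) (g r i v) - mdist u v| < e by near: i; exact: gd.
  have := gdi (pkg_dom_base (P i)) (a_ i); rewrite mdistxx => /(_ r0 (a_r i)).
  rewrite gx ltr_norml => /andP[lo _].
  have := fL i (pkg_dom_base (P i)) (a_ i); rewrite pkg_map_base.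
  move=> /le_lt_trans; apply.
  have : mdist (pkg_dom_base (P i)) (a_ i) < mdist (pkg_dom_base Q) a + 2 * e.
    by have := mdistD (pkg_dom_base Q) a (g r i (a_ i)); lra.
  by rewrite -(ltr_pM2l L0) mulrDr Le; lra.
split => //; apply: (ghii a r) => //.
- rewrite mdistC; apply: le_lt_trans Lar.
  by rewrite ler_peMl ?mdist_ge0.
- by move=> i; rewrite ball_mdistE.
- by apply: filterS fa_r => i; rewrite ball_mdistE.
Unshelve. all: by end_near. Qed.

End Limit.

Section LimitMap.
Context {R : realType}.
Context (P : nat -> mapping_package R) (Q : mapping_package R) (L : R).

Lemma limit_lipschitz : 1 <= L ->
  (forall i u v, mdist (@pkg_map R (P i) u) (@pkg_map R (P i) v) <= L * mdist u v) ->
  package_cvg P Q ->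
  forall a b, mdist (@pkg_map R Q a) (@pkg_map R Q b) <= L * mdist a b.
Proof.
move=> L1 fL PQ a b; have L0 : 0 < L by exact: lt_le_trans L1.
set x0 := pkg_dom_base Q.
pose r := L * (mdist x0 a + mdist x0 b) + 1.
have Lxa := mulr_ge0 (ltW L0) (mdist_ge0 x0 a).
have Lxb := mulr_ge0 (ltW L0) (mdist_ge0 x0 b).
have Lar : L * mdist x0 a < r by rewrite /r mulrDr; lra.
have Lbr : L * mdist x0 b < r by rewrite /r mulrDr; lra.
have lesc (c : R) : 0 <= c -> c <= L * c by move=> c0; rewrite ler_peMl.
have r0 : 0 < r by lra.
have [g [h [[_ gd gs] [_ hd _] fcvg]]] := package_cvg_asymptotic L1 r0 fL PQ.
have [a_ a_r a_a] := gs a (le_lt_trans (lesc _ (mdist_ge0 _ _)) Lar).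
have [b_ b_r b_b] := gs b (le_lt_trans (lesc _ (mdist_ge0 _ _)) Lbr).
have [fa_r fa_cvg] := fcvg a a_ Lar a_r a_a.
have [fb_r fb_cvg] := fcvg b b_ Lbr b_r b_b.
(* Three errors [e] arise in the domain, where they are multiplied by [L], and three in the
   codomain. *)
apply: (@ler_addMeps _ _ _ (3 * L + 3)) => [|e e0]; first by lra.
near \oo => i.
have fai : mdist (pkg_cod_base (P i)) (pkg_map (a_ i)) < r by near: i.
have fbi : mdist (pkg_cod_base (P i)) (pkg_map (b_ i)) < r by near: i.
have ga : mdist a (g i (a_ i)) < e.
  by near: i; exact: (cvg_mdistP _ _ _).1.
have gb : mdist b (g i (b_ i)) < e.
  by near: i; exact: (cvg_mdistP _ _ _).1.
have hfa : mdist (pkg_map a) (h i (pkg_map (a_ i))) < e.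
  by near: i; exact: (cvg_mdistP _ _ _).1.
have hfb : mdist (pkg_map b) (h i (pkg_map (b_ i))) < e.
  by near: i; exact: (cvg_mdistP _ _ _).1.
have gdi : forall u v, mdist (pkg_dom_base (P i)) u < r ->
    mdist (pkg_dom_base (P i)) v < r ->
    `|mdist (g i u) (g i v) - mdist u v| < e by near: i; exact: gd.
have hdi : forall u v, mdist (pkg_cod_base (P i)) u < r ->
    mdist (pkg_cod_base (P i)) v < r ->
    `|mdist (h i u) (h i v) - mdist u v| < e by near: i; exact: hd.
have := gdi _ _ (a_r i) (b_r i); rewrite ltr_norml => /andP[gab _].
have := hdi _ _ fai fbi; rewrite ltr_norml => /andP[_ hab].
have fab := fL i (a_ i) (b_ i).
have ab : mdist (a_ i) (b_ i) <= mdist a b + 3 * e.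
  have := mdistD (g i (a_ i)) a (g i (b_ i)).
  by have := mdistD a b (g i (b_ i)); rewrite (mdistC _ a); lra.
have Lab : L * mdist (a_ i) (b_ i) <= L * mdist a b + 3 * L * e.
  have -> : L * mdist a b + 3 * L * e = L * (mdist a b + 3 * e) by ring.
  by rewrite ler_pM2l.
have := mdistD (pkg_map a) (h i (pkg_map (a_ i))) (pkg_map b).
have := mdistD (h i (pkg_map (a_ i))) (h i (pkg_map (b_ i))) (pkg_map b).
rewrite (mdistC (h i (pkg_map (b_ i)))); lra.
Unshelve. all: by end_near. Qed.

(* [z] is a cluster point of [g i (z_ i)]. Since convergence of packages only
   speaks about full sequences, [pkg_map z] is computed with a sequence [v_]
   such that [g i (v_ i)] tends to [z], and [pkg_map (z_ i)] is compared with
   [pkg_map (v_ i)] by the Lipschitz bound. *)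
Lemma limit_colipschitz_near : 1 <= L ->
  (forall i u v, mdist (@pkg_map R (P i) u) (@pkg_map R (P i) v) <= L * mdist u v) ->
  (forall i u y c, L * mdist (@pkg_map R (P i) u) y < c ->
    exists2 z, pkg_map z = y & mdist u z < c) ->
  package_cvg P Q -> forall x, colipschitz_near L (@pkg_map R Q) x.
Proof.
move=> L1 fL fcoL PQ x; have L0 : 0 < L by exact: lt_le_trans L1.
set x0 := pkg_dom_base Q; set y0 := pkg_cod_base Q.
have [K [k [cK k0 kK]]] := locally_compact_mdist (pkg_dom_locally_compact (m := Q)) x.
have k4 : 0 < k / 4 by rewrite divr_gt0.
(* The points [g i (z_ i)] end up within [c + k / 4] of [a], hence within [k] of [x] and inside
   [K]. *)
exists (k / 4) => // a xa c /andP[c0 ck] y fyc.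
(* Large enough for [a], [y] and every point within [c] of [a], the cluster point included. *)
pose r := L * (mdist x0 a + c + 1) + mdist y0 y + 1.
have yr : mdist y0 y < r.
  by rewrite /r; have := mulr_ge0 (ltW L0) (mdist_ge0 x0 a); nra.
have Lcr : L * (mdist x0 a + c) < r.
  by rewrite /r; have := mdist_ge0 y0 y; nra.
have acr : mdist x0 a + c < r.
  by have := mdist_ge0 x0 a; nra.
have Lar : L * mdist x0 a < r by nra.
have r0 : 0 < r by exact: le_lt_trans (mdist_ge0 _ _) yr.
have ar : mdist x0 a < r by lra.
have [g [h [[gx gd gs] [_ hd hs] fcvg]]] := package_cvg_asymptotic L1 r0 fL PQ.
have [a_ a_r a_a] := gs a ar.
have [y_ y_r y_y] := hs y yr.
have [fa_r fa_cvg] := fcvg a a_ Lar a_r a_a.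
have ex i : exists z, L * mdist (pkg_map (a_ i)) (y_ i) < c ->
    pkg_map z = y_ i /\ mdist (a_ i) z < c.
  have [lt|nlt] := boolP (L * mdist (pkg_map (a_ i)) (y_ i) < c).
    by have [z fz az] := fcoL i _ _ _ lt; exists z.
  by exists (a_ i).
pose z_ i := sval (cid (ex i)).
have z_P i : L * mdist (pkg_map (a_ i)) (y_ i) < c ->
    pkg_map (z_ i) = y_ i /\ mdist (a_ i) (z_ i) < c.
  by rewrite /z_; case: cid.
have gd_ltr (e : R) : 0 < e -> \forall i \near \oo, forall u v,
    mdist (pkg_dom_base (P i)) u < r -> mdist (pkg_dom_base (P i)) v < r ->
    mdist (g i u) (g i v) < mdist u v + e /\ mdist u v < mdist (g i u) (g i v) + e.
  move=> e0; apply: filterS (gd e e0) => i H u v ur vr.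
  by have := H u v ur vr; rewrite ltr_norml => /andP[]; lra.
have hd_ltr (e : R) : 0 < e -> \forall i \near \oo, forall u v,
    mdist (pkg_cod_base (P i)) u < r -> mdist (pkg_cod_base (P i)) v < r ->
    mdist (h i u) (h i v) < mdist u v + e /\ mdist u v < mdist (h i u) (h i v) + e.
  move=> e0; apply: filterS (hd e e0) => i H u v ur vr.
  by have := H u v ur vr; rewrite ltr_norml => /andP[]; lra.
have z_good : \forall i \near \oo, [/\ pkg_map (z_ i) = y_ i,
    mdist (a_ i) (z_ i) < c & mdist (pkg_dom_base (P i)) (z_ i) < r].
  pose e := (c - L * mdist (pkg_map a) y) / (4 * L).
  have e0 : 0 < e by rewrite divr_gt0 ?subr_gt0// mulr_gt0.
  have Le : L * (4 * e) = c - L * mdist (pkg_map a) y.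
    by rewrite /e; field; rewrite gt_eqF.
  (* Two errors [e'] fill the room between [mdist x0 a + c] and [r], which keeps [z_ i] in the ball
     of radius [r]. *)
  pose e' := (r - (mdist x0 a + c)) / 2.
  have e'0 : 0 < e' by rewrite divr_gt0// subr_gt0.
  near=> i.
  have fai : mdist (pkg_cod_base (P i)) (pkg_map (a_ i)) < r by near: i.
  have hfa : mdist (pkg_map a) (h i (pkg_map (a_ i))) < e.
    by near: i; exact: (cvg_mdistP _ _ _).1.
  have hy : mdist y (h i (y_ i)) < e.
    by near: i; exact: (cvg_mdistP _ _ _).1.
  have hdi : forall u v, mdist (pkg_cod_base (P i)) u < r ->
    mdist (pkg_cod_base (P i)) v < r ->
    mdist (h i u) (h i v) < mdist u v + e /\ mdist u v < mdist (h i u) (h i v) + e.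
    by near: i; exact: hd_ltr.
  have [fz az] : pkg_map (z_ i) = y_ i /\ mdist (a_ i) (z_ i) < c.
    apply: z_P.
    have [_ lt] := hdi _ _ fai (y_r i).
    have : mdist (pkg_map (a_ i)) (y_ i) < mdist (pkg_map a) y + 4 * e.
      have := mdistD (h i (pkg_map (a_ i))) (pkg_map a) (h i (y_ i)).
      have := mdistD (pkg_map a) y (h i (y_ i)).
      by rewrite (mdistC _ (pkg_map a)); lra.
    by rewrite -(ltr_pM2l L0) mulrDr Le; lra.
  split => //.
  have ga : mdist a (g i (a_ i)) < e'.
    by near: i; exact: (cvg_mdistP _ _ _).1.
  have gdi : forall u v, mdist (pkg_dom_base (P i)) u < r ->
    mdist (pkg_dom_base (P i)) v < r ->
    mdist (g i u) (g i v) < mdist u v + e' /\ mdist u v < mdist (g i u) (g i v) + e'.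
    by near: i; exact: gd_ltr.
  have [|_] := gdi (pkg_dom_base (P i)) (a_ i) _ (a_r i); first by rewrite mdistxx.
  rewrite gx -/x0.
  have := mdistD x0 a (g i (a_ i)).
  have := mdistD (pkg_dom_base (P i)) (a_ i) (z_ i).
  have : 2 * e' = r - (mdist x0 a + c) by rewrite /e'; field.
  lra.
have gz_near (e : R) : 0 < e -> \forall i \near \oo, mdist a (g i (z_ i)) < c + e.
  move=> e0; have e20 : 0 < e / 2 by rewrite divr_gt0.
  near=> i.
  have [_ az zr] : [/\ pkg_map (z_ i) = y_ i,
    mdist (a_ i) (z_ i) < c & mdist (pkg_dom_base (P i)) (z_ i) < r] by near: i.
  have ga : mdist a (g i (a_ i)) < e / 2.
    by near: i; exact: (cvg_mdistP _ _ _).1.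
  have gdi : forall u v, mdist (pkg_dom_base (P i)) u < r ->
    mdist (pkg_dom_base (P i)) v < r ->
    mdist (g i u) (g i v) < mdist u v + e / 2 /\
    mdist u v < mdist (g i u) (g i v) + e / 2.
    by near: i; exact: gd_ltr.
  have [lt _] := gdi _ _ (a_r i) zr.
  by have := mdistD a (g i (a_ i)) (g i (z_ i)); lra.
have [|z Kz zz] := compact_cluster_seq (u := fun i => g i (z_ i)) cK.
  apply: filterS (gz_near _ k4) => i agz; apply: kK.
  by have := mdistD x a (g i (z_ i)); lra.
have az : mdist a z <= c.
  apply: (@ler_addMeps _ _ _ 2) => // e e0.
  have [i /= agz zgz] := zz _ _ e0 (gz_near e e0).
  by have := mdistD a (g i (z_ i)) z; rewrite (mdistC (g i (z_ i))); lra.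
exists z => //.
have xz : mdist x0 z <= mdist x0 a + c.
  by have := mdistD x0 a z; lra.
have Lzr : L * mdist x0 z < r.
  by apply: le_lt_trans Lcr; rewrite ler_pM2l.
have [v_ v_r v_z] := gs z (le_lt_trans xz acr).
have [fv_r fv_cvg] := fcvg z v_ Lzr v_r v_z.
apply/mdist_positivity/eqP; rewrite eq_le mdist_ge0 andbT.
apply: (@ler_addMeps _ _ _ (3 * L + 3)) => [|e e0]; first by lra.
rewrite add0r.
have : \forall i \near \oo, [/\ pkg_map (z_ i) = y_ i,
    mdist (pkg_map z) (h i (pkg_map (v_ i))) < e,
    mdist y (h i (y_ i)) < e,
    mdist (z_ i) (v_ i) < mdist (g i (z_ i)) z + 2 * e &
    mdist (h i (pkg_map (v_ i))) (h i (y_ i)) < mdist (pkg_map (v_ i)) (y_ i) + e].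
  near=> i.
  have [fz _ zr] : [/\ pkg_map (z_ i) = y_ i,
    mdist (a_ i) (z_ i) < c & mdist (pkg_dom_base (P i)) (z_ i) < r] by near: i.
  have gdi : forall u v, mdist (pkg_dom_base (P i)) u < r ->
    mdist (pkg_dom_base (P i)) v < r ->
    mdist (g i u) (g i v) < mdist u v + e /\
    mdist u v < mdist (g i u) (g i v) + e.
    by near: i; exact: gd_ltr.
  have hdi : forall u v, mdist (pkg_cod_base (P i)) u < r ->
    mdist (pkg_cod_base (P i)) v < r ->
    mdist (h i u) (h i v) < mdist u v + e /\ mdist u v < mdist (h i u) (h i v) + e.
    by near: i; exact: hd_ltr.
  have fvi : mdist (pkg_cod_base (P i)) (pkg_map (v_ i)) < r by near: i.
  have gv : mdist z (g i (v_ i)) < e.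
    by near: i; exact: (cvg_mdistP _ _ _).1.
  split=> //.
  - by near: i; exact: (cvg_mdistP _ _ _).1.
  - by near: i; exact: (cvg_mdistP _ _ _).1.
  - have [_ lt] := gdi _ _ zr (v_r i).
    by have := mdistD (g i (z_ i)) z (g i (v_ i)); lra.
  - by have [lt _] := hdi _ _ fvi (y_r i).
(* All these estimates hold eventually, while [g i (z_ i)] is near [z] only for some indices; one
   index with both is enough. *)
move=> /(zz e _ e0)[i [fz hfv hy zv hvy] zgz].
have := fL i (z_ i) (v_ i); rewrite fz => fzv.
have Lzv : L * mdist (z_ i) (v_ i) <= 3 * L * e.
  have -> : 3 * L * e = L * (3 * e) by ring.
  rewrite ler_pM2l//.
  by move: zv; rewrite (mdistC _ z) => zv; lra.
move: hvy; rewrite (mdistC (pkg_map (v_ i))) => hvy.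
have := mdistD (pkg_map z) (h i (pkg_map (v_ i))) y.
have := mdistD (h i (pkg_map (v_ i))) (h i (y_ i)) y.
rewrite (mdistC (h i (y_ i)) y); lra.
Unshelve. all: by end_near. Qed.

End LimitMap.

Theorem theorem1p2 (R : realType) (L : R) (P : nat -> mapping_package R)
    (Q : mapping_package R) :
  1 <= L ->
  (forall j, BLD L (@pkg_map R (P j))) ->
  package_cvg P Q ->
  discrete_map (@pkg_map R Q) ->
  BLD L (@pkg_map R Q).
Proof.
move=> L1 fBLD PQ fd; have L0 : 0 < L by exact: lt_le_trans L1.
have fL i := BLD_lipschitz L0 (pkg_dom_path_metric (m := P i)) (fBLD i).
have fcoL i := BLD_colipschitz L0 (pkg_dom_locally_compact (m := P i))
  (pkg_dom_complete (m := P i)) (pkg_cod_path_metric (m := P i)) (fBLD i).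
apply: discrete_lipschitz_quotient_BLD => //.
- exact: pkg_map_continuous.
- exact: limit_lipschitz L1 fL PQ.
- exact: limit_colipschitz_near L1 fL fcoL PQ.
Qed.
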